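(* For all integers $n\ge 3$ and all integers $\xi$ with $\frac{n}{\log n}\le \xi\le\frac n2$, the largest eigenvalue $\beta(\xi)$ of $M(\xi)$ satisfies $$\beta(\xi)\le 1-\frac34\left(\frac{\xi}{n}\right)^2.$$
   Context: For integers $n\ge 3$ and $\xi$, $M(\xi)$ is the real symmetric $n\times n$ matrix with rows and columns indexed by $0,1,\dots,n-1$, with diagonal entries $\frac12\cos\left(\frac{2\pi\xi j}{n}\right)$ for $0\le j\le n-1$, entries $\frac14$ on the superdiagonal and the subdiagonal and in the upper right and lower left corners, and all other entries $0$. Here $\log$ is the natural logarithm. *)

(* Defs.v *)
From HB Require Import structures.
From mathcomp Require Import all_boot all_order all_algebra.
From mathcomp Require Import all_classical all_reals all_analysis.

Set Implicit Arguments.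
Unset Strict Implicit.
Unset Printing Implicit Defensive.

Import Order.TTheory GRing.Theory Num.Theory.
Local Open Scope ring_scope.

Definition cyc_adjacent (n : nat) (i j : 'I_n) : bool :=
  [|| (j == i.+1 :> nat), (i == j.+1 :> nat),
      (i == 0%N :> nat) && (j == n.-1 :> nat)
    | (i == n.-1 :> nat) && (j == 0%N :> nat)].

(* The intended range is n >= 3, where the diagonal, the sub/superdiagonal and
   the two corners are pairwise disjoint. *)
Definition Mxi (R : realType) (n : nat) (xi : int) : 'M[R]_n :=
  \matrix_(i < n, j < n)
    if i == j then 2^-1 * cos (2 * pi * xi%:~R * j%:R / n%:R)
    else if cyc_adjacent i j then 4^-1
    else 0.

Definition is_largest_eigenvalue (R : realType) (n : nat) (A : 'M[R]_n)
    (b : R) : Prop :=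
  eigenvalue A b /\ forall a : R, eigenvalue A a -> a <= b.

(* Main.v *)
(* Off the diagonal M(xi) is nonnegative, so M v <= lam v for a positive v bounds
   every real eigenvalue by lam.  With th = 2 pi xi / n, s = sin(th / 2) and
   v_j = 1 + (3/13) cos (th j), this holds for lam = 1 - (3/16) s^2, and
   s >= 2 xi / n because the sine lies above its chord on [0, pi/2].  The weight
   3/13 is chosen so that the resulting constant is exactly 3/4. *)
Require Import Defs.
From HB Require Import structures.
From mathcomp Require Import all_boot all_order all_algebra.
From mathcomp Require Import all_classical all_reals all_analysis.
From mathcomp Require Import ring lra zify.

Import Order.TTheory GRing.Theory Num.Theory.
Import numFieldNormedType.Exports.
Local Open Scope ring_scope.

(** A maximum principle: for a left eigenvector [u], take the index [j] where [|u 0 j| / v j] is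
    largest, with value [r]. Moving the diagonal term of column [j] aside and taking absolute values
    bounds [(a - A j j) * |u 0 j|] by [r] times the off-diagonal part of the hypothesis at [j]. *)
Lemma le_eigenvalue_supersolution (R : realFieldType) (n : nat) (A : 'M[R]_n)
    (v : 'I_n -> R) (lam a : R) :
  (forall i j, i != j -> 0 <= A i j) -> (forall i, 0 < v i) ->
  (forall j, \sum_i v i * A i j <= lam * v j) ->
  eigenvalue A a -> a <= lam.
Proof.
move=> A_ge0 v_gt0 Av /eigenvalueP[u uA /rV0Pn[k uk_neq0]].
have [j _ u_max] := arg_maxP (fun i => `|u 0 i| / v i) (erefl : xpredT k).
set r := `|u 0 j| / v j.
have u_le i : `|u 0 i| / v i <= r := u_max i isT.
have r_gt0 : 0 < r.
  by apply: lt_le_trans (u_le k); rewrite divr_gt0 ?normr_gt0.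
have uE i : `|u 0 i| <= r * v i by rewrite -ler_pdivrMr.
have ujE : `|u 0 j| = r * v j by rewrite divfK ?gt_eqF.
have eigj : (a - A j j) * u 0 j = \sum_(i | i != j) u 0 i * A i j.
  have /matrixP/(_ 0 j) := uA; rewrite !mxE (bigD1 j) //= addrC.
  by rewrite mulrBl (mulrC (A j j)) => <-; rewrite addrK.
have offdiag : \sum_(i | i != j) v i * A i j <= (lam - A j j) * v j.
  by have := Av j; rewrite (bigD1 j) //= mulrBl; lra.
have : (a - A j j) * (r * v j) <= r * ((lam - A j j) * v j).
  rewrite -ujE; apply: le_trans (_ : r * \sum_(i | i != j) v i * A i j <= _);
    last by rewrite ler_pM2l.
  apply: le_trans (ler_norm _) _; rewrite normrM normr_id -normrM eigj.
  apply: le_trans (ler_norm_sum _ _ _) _; rewrite mulr_sumr.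
  apply: ler_sum => i ij; rewrite normrM (ger0_norm (A_ge0 _ _ ij)) mulrA.
  by rewrite ler_wpM2r ?A_ge0 ?uE.
by rewrite mulrCA ler_pM2l // ler_pM2r // lerD2r.
Qed.

(** Concavity through the mean value theorem: the slope of the sine on [[0, x]] is at least its
    slope on [[x, pi / 2]], because the cosine decreases. *)
Lemma sin_ge_chord (R : realType) (x : R) :
  0 <= x <= pi / 2 -> x <= pi / 2 * sin x.
Proof.
move=> /andP[]; rewrite le_eqVlt => /predU1P[<-|x_gt0].
  by rewrite sin0 mulr0.
rewrite le_eqVlt => /predU1P[->|x_lt]; first by rewrite sin_pihalf mulr1.
have csin a b : {within `[a, b], continuous (@sin R)}%classic.
  by apply: continuous_subspaceT => y; exact: continuous_sin.
have [c1] := MVT x_gt0 (fun y _ => is_derive_sin y) (csin _ _).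
have [c2] := MVT x_lt (fun y _ => is_derive_sin y) (csin _ _).
rewrite !in_itv /= sin0 sin_pihalf !subr0 => /andP[xc2 c2_lt] E2 /andP[c1_gt0 c1x] E1.
have pi0 := pi_gt0 R.
have cosle : cos c2 <= cos c1.
  by rewrite ltW // ltr_cos ?in_itv /=; lra.
(* Clearing denominators in the slope comparison leaves [sin x * (pi / 2 - x) - (1 - sin x) * x],
   which is [pi / 2 * sin x - x]. *)
have : 0 <= (cos c1 - cos c2) * (x * (pi / 2 - x)) by rewrite !mulr_ge0; lra.
have -> : (cos c1 - cos c2) * (x * (pi / 2 - x)) =
   (cos c1 * x) * (pi / 2 - x) - (cos c2 * (pi / 2 - x)) * x by ring.
by rewrite -E1 -E2; lra.
Qed.

Lemma cosD_int2pi (R : realType) (x : R) (k : int) :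
  cos (x + 2 * pi * k%:~R) = cos x.
Proof.
have cosDn (y : R) m : cos (y + 2 * pi * m%:R) = cos y.
  by rewrite (_ : 2 * pi * m%:R = pi *+ 2 *+ m) ?(periodicn (@cosD2pi R)) //; ring.
case: k => m; first exact: cosDn.
by rewrite NegzE -(cosDn _ m.+1) -addrA -mulrDr intrN addNr mulr0 addr0.
Qed.

(** Removing a multiple of [n] from the index shifts the angle by a multiple of [2 * pi * xi], so
    the test vector is compatible with cyclic indexing. *)
Lemma cos_mod (R : realType) (n : nat) (xi : int) (j : nat) : (0 < n)%N ->
  cos (2 * pi * xi%:~R / n%:R * (j %% n)%:R) =
  cos (2 * pi * xi%:~R / n%:R * j%:R) :> R.
Proof.
move=> n_gt0; have n0 : n%:R != 0 :> R by rewrite pnatr_eq0 -lt0n.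
rewrite -(cosD_int2pi _ _ (xi * (j %/ n)%:Z)) intrM; congr cos.
by rewrite [in RHS](divn_eq j n) natrD natrM pmulrn; field.
Qed.

Lemma cyc_adjacentE (n : nat) (i j : 'I_n) : (2 < n)%N ->
  cyc_adjacent i j = (i == ordS j) || (i == ord_pred j).
Proof.
move=> n2; rewrite /cyc_adjacent -!val_eqE /=.
have lt_in := ltn_ord i; have lt_jn := ltn_ord j.
have -> : (j.+1 %% n = if j == n.-1 :> nat then 0 else j.+1)%N.
  case: eqP => [->|jn]; first by rewrite prednK ?modnn; lia.
  by rewrite modn_small; lia.
have -> : ((j + n).-1 %% n = if j == 0 :> nat then n.-1 else j.-1)%N.
  case: eqP => [->|j0]; first by rewrite modn_small; lia.
  have -> : (j + n).-1 = (j.-1 + n)%N by lia.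
  by rewrite modnDr modn_small; lia.
by case: (nat_of_ord j =P n.-1); case: (nat_of_ord j =P 0%N); lia.
Qed.

(** With [c = cos (th * j)], the cosines at the two cyclic neighbours add up to [2 * cos th * c], so
    every column condition becomes the same inequality in the single variable [c]. *)
Lemma Mxi_supersolution (R : realType) (n : nat) (xi : int) (a lam : R)
    (th := 2 * pi * xi%:~R / n%:R) (v := fun i : 'I_n => 1 + a * cos (th * i%:R)) :
  (2 < n)%N -> (forall i, 0 <= v i) ->
  (forall c : R, -1 <= c <= 1 ->
     c / 2 * (1 + a * c) + (1 + a * cos th * c) / 2 <= lam * (1 + a * c)) ->
  forall j, \sum_i v i * Mxi R n xi i j <= lam * v j.
Proof.
move=> n2 v_ge0 supersol j; have n_gt0 : (0 < n)%N by lia.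
rewrite (bigD1 j) //=.
apply: le_trans (supersol (cos (th * j%:R)) _); last by rewrite cos_geN1 cos_le1.
rewrite mxE eqxx; apply: lerD.
  rewrite le_eqVlt; apply/orP; left; apply/eqP.
  by rewrite mulrC -[_ * j%:R / _]mulrAC /v /th; ring.
(* Splitting the disjunction into two indicators can only increase the sum, since [v] is
   nonnegative. *)
apply: le_trans (_ : \sum_i ((if i == ordS j then v i / 4 else 0) +
                     (if i == ord_pred j then v i / 4 else 0)) <= _).
  rewrite [leLHS]big_mkcond; apply: ler_sum => i _.
  rewrite mxE cyc_adjacentE //; have := v_ge0 i.
  by case: eqP; case: eqP; case: eqP => //=; lra.
rewrite big_split -!big_mkcond !big_pred1_eq /v /= !cos_mod // -/th.
have -> : cos (th * (j + n).-1%:R) = cos (th * j%:R - th).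
  rewrite -(cosD_int2pi _ (_ - _) xi); congr cos.
  have -> : (j + n).-1%:R = j%:R + n%:R - 1 :> R.
    by rewrite -natrD -subn1 natrB //; lia.
  by rewrite /th; field; rewrite pnatr_eq0 -lt0n.
have -> : th * j.+1%:R = th * j%:R + th by rewrite -natr1 mulrDr mulr1.
by rewrite cosD cosB; lra.
Qed.

Theorem proposition4 (R : realType) (n : nat) (xi : int) (beta : R)
    (hn : (3 <= n)%N)
    (hxi_lower : n%:R / ln n%:R <= xi%:~R :> R)
    (hxi_upper : xi%:~R <= n%:R / 2 :> R)
    (hbeta : is_largest_eigenvalue (Mxi R n xi) beta) :
  beta <= 1 - 3 / 4 * (xi%:~R / n%:R) ^+ 2.
Proof.
have n_gt0 : 0 < n%:R :> R by rewrite ltr0n; lia.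
set t : R := xi%:~R / n%:R.
have t_ge0 : 0 <= t.
  rewrite divr_ge0 ?ler0n //; apply: le_trans hxi_lower.
  by rewrite divr_ge0 ?ler0n // ln_ge0 // ler1n; lia.
have t_le : t <= 2^-1 by rewrite ler_pdivrMr // mulrC.
have pi0 := pi_gt0 R.
set s := sin (pi * t).
have s_ge : 2 * t <= s.
  have : pi * t <= pi / 2 * s.
    by apply: sin_ge_chord; rewrite mulr_ge0 ?pi_ge0 ?ler_pM2l.
  by rewrite -mulrA ler_pM2l //; lra.
have s_le1 : s <= 1 := sin_le1 _.
have s2_le1 : s ^+ 2 <= 1 by rewrite expr_le1 //; lra.
have s2_ge0 : 0 <= s ^+ 2 by rewrite sqr_ge0.
have costh : cos (2 * pi * xi%:~R / n%:R) = 1 - 2 * s ^+ 2.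
  rewrite (_ : 2 * pi * xi%:~R / n%:R = (pi * t) *+ 2); last by rewrite /t; ring.
  by rewrite cos_mulr2n cos2sin2 -/s; ring.
apply: le_trans (_ : 1 - 3 / 16 * s ^+ 2 <= _); last first.
  have : (2 * t) ^+ 2 <= s ^+ 2 by rewrite ler_sqr ?nnegrE; lra.
  by rewrite exprMn; lra.
(* For [lam = 1 - k * s ^+ 2] and weight [a], equality at [c = 1] for every [s] forces
   [a = k / (1 - k)]; here [k = 3/16]. *)
pose v (i : 'I_n) : R := 1 + 3 / 13 * cos (2 * pi * xi%:~R / n%:R * i%:R).
have v_gt0 i : 0 < v i.
  by have := cos_geN1 (2 * pi * xi%:~R / n%:R * i%:R : R); rewrite /v; lra.
have [beta_eig _] := hbeta.
apply: (le_eigenvalue_supersolution _ _ _ v) beta_eig.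
- by move=> i j /negbTE ij; rewrite mxE ij; case: ifP => // _; lra.
- exact: v_gt0.
apply: Mxi_supersolution => // [i|c]; first exact: ltW (v_gt0 i).
rewrite costh => /andP[c_ge c_le].
(* The right side minus the left is a quadratic in c vanishing at c = 1. *)
have : 0 <= (1 - c) * (1 / 2 - 3 / 16 * s ^+ 2 + 3 / 26 * c).
  (* The second factor is smallest at [c = -1], [s ^+ 2 = 1], where it equals 41/208. *)
  by rewrite mulr_ge0; lra.
by lra.
Qed.
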